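(* Let $G$ be a finite distributive group and let $A$ be a subgroup of $G$ such that for every $p\in G$ there is $t\in G$ with $A.(A.p)=A.t$. Then there are elements $p,q,\dots,w\in G$ such that $G$ is the disjoint union $$G=A+A.p+A.q+\cdots+A.w .$$
   Context: A distributive group is a nonempty set $G$ with a binary operation $(a,b)\mapsto a.b$ on $G$ such that for all $a,b\in G$ each of the equations $a.x=b$ and $y.a=b$ has exactly one solution in $G$, and for all $a,b,c\in G$, $(a.b).c=(a.c).(b.c)$ and $c.(a.b)=(c.a).(c.b)$. A subgroup of $G$ is a nonempty subset which is itself a distributive group under the restricted operation. For subsets $X,Y\subseteq G$ and $p\in G$: $X.Y=\{x.y: x\in X,\,y\in Y\}$ and $X.p=\{x.p: x\in X\}$. The symbol $+$ between subsets denotes union of pairwise disjoint sets. *)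

(* Defs.v *)
From mathcomp Require Import all_boot.

Set Implicit Arguments.
Unset Strict Implicit.
Unset Printing Implicit Defensive.

Record distributive_group (T : Type) (op : T -> T -> T) : Prop :=
  DistributiveGroup {
    dg_nonempty : inhabited T;
    dg_soll : forall a b, exists! x, op a x = b;
    dg_solr : forall a b, exists! y, op y a = b;
    dg_distl : left_distributive op op;
    dg_distr : right_distributive op op
  }.

Definition op_closed (T : finType) (op : T -> T -> T) (A : {set T}) : Prop :=
  forall x y, x \in A -> y \in A -> op x y \in A.

Definition restricted_op (T : finType) (op : T -> T -> T) (A : {set T})
    (clA : op_closed op A) (x y : {x | x \in A}) : {x | x \in A} :=
  exist _ (op (sval x) (sval y)) (clA _ _ (svalP x) (svalP y)).

(* Nonemptiness of A is part of distributive_group on the subtype. *)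
Definition dg_subgroup (T : finType) (op : T -> T -> T) (A : {set T}) : Prop :=
  exists clA : op_closed op A, distributive_group (restricted_op clA).

Definition set_op (T : finType) (op : T -> T -> T) (X Y : {set T}) : {set T} :=
  [set op x y | x in X, y in Y].

Definition set_op_elt (T : finType) (op : T -> T -> T) (X : {set T}) (p : T) :
    {set T} :=
  [set op x p | x in X].

(* Disjointness is by position in the list: a nonempty set occurring twice
   is not disjoint from itself. *)
Definition disjoint_sum (T : finType) (S : {set T}) (Xs : seq {set T}) : Prop :=
  pairwise (fun X Y : {set T} => [disjoint X & Y]) Xs
  /\ S = \bigcup_(X <- Xs) X.

(* Main.v *)
Require Import Defs.
From mathcomp Require Import all_boot.

(** The theorem says that the right translates [A.p] partition [G].  They cover
    [G] because [a.p = x] is solvable in [p], and [A] itself is the translate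
    [A.a] for any [a] in [A], so the point is that two translates sharing an
    element coincide.

    All translates have [#|A|] elements.  For [a] in [A], the set [a.(A.p)] is
    contained in [A.(A.p)], which by hypothesis is a translate; by counting the
    two sets are equal, so [a.(A.p)] does not depend on [a]
    ([lmul_translate_indep]).  Moreover left distributivity and [a.A = A] give
    [A.(a.p) = a.(A.p)] ([translate_lmul]).  If now [x = a.p = b.q] with [a] and
    [b] in [A], then
    [a.(A.p) = A.x = b.(A.q) = a.(A.q)],
    and cancelling [a] on the left yields [A.p = A.q]. *)

Section Translates.

Set Implicit Arguments.
Unset Strict Implicit.

Variables (G : finType) (op : G -> G -> G) (A : {set G}).
Hypothesis hG : distributive_group op.

Lemma op_injl a : injective (op a).
Proof.
move=> x y eq_xy; have [z [_ uniq_z]] := dg_soll hG a (op a y).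
by rewrite -(uniq_z x eq_xy) -(uniq_z y erefl).
Qed.

Lemma op_injr p : injective (op^~ p).
Proof.
move=> x y eq_xy; have [z [_ uniq_z]] := dg_solr hG p (op y p).
by rewrite -(uniq_z x eq_xy) -(uniq_z y erefl).
Qed.

Local Notation translate := (set_op_elt op A).

Lemma card_translate p : #|translate p| = #|A|.
Proof. exact/card_imset/op_injr. Qed.

Hypothesis clA : op_closed op A.

Lemma translate_id a : a \in A -> translate a = A.
Proof.
move=> Aa; apply/eqP; rewrite eqEcard card_translate leqnn andbT.
by apply/subsetP=> _ /imsetP[x Ax ->]; apply: clA.
Qed.

Lemma lmul_id a : a \in A -> op a @: A = A.
Proof.
move=> Aa; apply/eqP; rewrite eqEcard.
rewrite card_imset ?leqnn ?andbT; last exact: op_injl.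
by apply/subsetP=> _ /imsetP[x Ax ->]; apply: clA.
Qed.

Lemma translate_lmul a p : a \in A -> translate (op a p) = op a @: translate p.
Proof.
move=> Aa; rewrite /set_op_elt -imset_comp -{1}(lmul_id Aa) -imset_comp.
by apply: eq_imset => x /=; rewrite -(dg_distr hG).
Qed.

Hypothesis hAA : forall p, exists t, set_op op A (translate p) = translate t.

(** All the sets [a.(A.p)] with [a] in [A] lie in the single translate
    [A.(A.p)] and have its cardinality, hence they all fill it. *)
Lemma lmul_translate a p :
  a \in A -> op a @: translate p = set_op op A (translate p).
Proof.
move=> Aa; apply/eqP; rewrite eqEcard; apply/andP; split.
  by apply/subsetP=> _ /imsetP[x px ->]; apply: imset2_f.
have [t ->] := hAA p; rewrite card_imset; last exact: op_injl.
by rewrite !card_translate.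
Qed.

Lemma lmul_translate_indep a b p :
  a \in A -> b \in A -> op a @: translate p = op b @: translate p.
Proof. by move=> Aa Ab; rewrite !lmul_translate. Qed.

Lemma translate_eq x p q :
  x \in translate p -> x \in translate q -> translate p = translate q.
Proof.
case/imsetP=> a Aa ->{x} /imsetP[b Ab eq_apbq].
apply: (imset_inj (@op_injl a)).
by rewrite -translate_lmul // eq_apbq translate_lmul //
  (lmul_translate_indep q Ab Aa).
Qed.

Lemma translate_disjoint p q :
  translate p != translate q -> [disjoint translate p & translate q].
Proof.
apply: contraR => /pred0Pn[x /andP[px qx]].
by rewrite (translate_eq px qx).
Qed.

End Translates.

Theorem theorem4p4 (G : finType) (op : G -> G -> G) (A : {set G})
    (hG : distributive_group op)
    (hA : dg_subgroup op A)
    (hAA : forall p : G, exists t : G,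
       set_op op A (set_op_elt op A p) = set_op_elt op A t) :
  exists ps : seq G,
    disjoint_sum [set: G] (A :: [seq set_op_elt op A p | p <- ps]).
Proof.
have [clA [[[a Aa]] _ _ _ _]] := hA.
have Aa_id := translate_id hG clA Aa.
(* The set of translates is listed with [A] first; the representatives are then
   any preimages of the remaining ones. *)
pose cosets := [set set_op_elt op A p | p in G].
have [ps def_ps] : exists ps, enum (cosets :\ A) = map (set_op_elt op A) ps.
  have: {subset enum (cosets :\ A) <= cosets}.
    by move=> X; rewrite mem_enum => /setD1P[].
  elim: (enum _) => [|X s IHs] sub_s; first by exists [::].
  have /imsetP[p _ ->] := sub_s X (mem_head X s).
  have [Y sY|ps ->] := IHs; first by apply: sub_s; rewrite inE sY orbT.
  by exists (p :: ps).
have mem_cosets X : (X \in A :: enum (cosets :\ A)) = (X \in cosets).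
  rewrite inE mem_enum !inE; case: eqVneq => [->|//].
  by rewrite -Aa_id imset_f.
exists ps; rewrite -def_ps; split.
  have: uniq (A :: enum (cosets :\ A)) by rewrite /= mem_enum !inE eqxx enum_uniq.
  rewrite uniq_pairwise; apply: (sub_in_pairwise (P := mem cosets)).
    move=> _ _ /imsetP[p _ ->] /imsetP[q _ ->].
    exact: translate_disjoint hG clA hAA p q.
  by apply/allP=> X; rewrite mem_cosets.
apply/esym/setP=> x; rewrite inE.
have [p [def_x _]] := dg_soll hG a x.
have cosets_p: set_op_elt op A p \in A :: enum (cosets :\ A).
  by rewrite mem_cosets imset_f.
have px: x \in set_op_elt op A p by rewrite -def_x imset_f.
by rewrite (big_rem _ cosets_p) /= inE px.
Qed.
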